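(* Let $f\in\mathbb{R}[x_1,\ldots,x_n]$ be a nonzero homogeneous polynomial, and for a positive integer $N$ let $\psi_N(x)=(x_1^2+\cdots+x_n^2)^Nf(x)$. The following conditions are equivalent: (a) $f(x)>0$ for all $x\in\mathbb{R}^n\setminus\{0\}$; (b) there exists $N_1\in\mathbb{N}$ such that for any $N\ge N_1$ the polynomial $\psi_N$ is a sum of even powers of linear functions; (c) there exists $N_2\in\mathbb{N}$ such that for any $N\ge N_2$ the polynomial $\psi_N$ is a convex function on $\mathbb{R}^n$; (d) there exists $N_3\in\mathbb{N}$ such that for any $N\ge N_3$ the polynomial $\psi_N$ is a strictly convex function on $\mathbb{R}^n$.
   Context: ''Linear functions'' are homogeneous linear forms on $\mathbb{R}^n$ with real coefficients; sums are finite. $N$ ranges over positive integers. *)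

(* Defs.v *)
From mathcomp Require Import all_boot all_order all_algebra.
From mathcomp Require Import mpoly.
From mathcomp Require Import classical_sets reals interval_inference convex.

Set Implicit Arguments.
Unset Strict Implicit.
Unset Printing Implicit Defensive.

Import Order.TTheory GRing.Theory Num.Theory.

Local Open Scope ring_scope.
Local Open Scope convex_scope.

(* Same format as [convex_function]; the weights 0 and 1 and the degenerate
   segments, where equality always holds, are excluded. *)
Definition strictly_convex_function (R : numFieldType) (E : lmodType R)
    (E' := convex_lmodType E) (D : set E') (f : E' -> R^o) :=
  forall t : {i01 R}, 0 < t%:num -> t%:num < 1 ->
    {in D &, forall x y : E', x != y ->
      (f (x <| t |> y) < f x <| t |> f y)%R}.

Section Psi.
Context {R : realType} {n : nat}.
Implicit Types (p f : {mpoly R[n]}) (N : nat).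

Definition psi f N : {mpoly R[n]} := (\sum_(i < n) 'X_i ^+ 2) ^+ N * f.

Definition polyfun p (x : 'rV[R]_n) : R := p.@[x 0].

(* [1.-homog] contains the zero form. The exponents 2 * k i may differ from
   term to term, and exponent 0 (a constant term 1) is excluded. *)
Definition sum_of_even_powers_of_linear p : Prop :=
  exists (m : nat) (l : 'I_m -> {mpoly R[n]}) (k : 'I_m -> nat),
    [/\ forall i, l i \is 1.-homog,
        forall i, (0 < k i)%N
      & p = \sum_(i < m) l i ^+ (2 * k i)].

End Psi.

(* Main.v *)
(** Fix [S = x_1^2 + ... + x_n^2].

    From (a) to (b) (Reznick).  Gauss-Hermite quadrature gives a finitely supported
    measure on the line with the Gaussian moments up to any given order; its n-th power
    yields Hilbert's identity [S^r = sum_t c_t l_t^(2r)] with [c_t >= 0].  Applying the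
    operator [h(D)] to it, for a form [h] of degree [d], gives
    [S^s h + S^(s+1) G_s = sum_t c'_t h(a_t) l_t^(2s+d)] with [c'_t >= 0], where [a_t] is
    the coefficient vector of [l_t] and the coefficients of [G_s] are [O(1/s)].  If
    [f >= e S^m] has degree [d = 2m], take [h = f - (e/2) S^m], which is nonnegative:
    [S^s f = (S^s h + S^(s+1) G_s) + S^(s+1) ((e/2) S^(m-1) - G_s)],
    and the second summand is handled by induction on [m], because its cofactor is a
    form of degree [2m-2] bounded below by [(e/4) S^(m-1)] for large [s].

    From (c) to (a).  Convexity and homogeneity force [d] to be even and [f >= 0].  If
    [f x = 0], then for every [z] both [psi f N] and [psi f N.+1] are comparable along
    [z + R x] to their values at [z], so that [S = psi f N.+1 / psi f N] would be bounded there.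

    From (c) to (d).  A convex polynomial that is not strictly convex is affine on a
    line, while [psi f N] has degree at least 2 on every line. *)

Require Import Defs.
From HB Require Import structures.
From mathcomp Require Import all_boot all_order all_algebra.
From mathcomp Require Import complex.
From mathcomp Require Import mpoly.
From mathcomp Require Import classical_sets reals interval_inference convex.
From mathcomp Require Import ring lra.
Set Implicit Arguments.
Unset Strict Implicit.
Unset Printing Implicit Defensive.

Import Order.TTheory GRing.Theory Num.Theory.

Local Open Scope ring_scope.

(** * Gaussian moments, Hermite polynomials and Gauss quadrature *)

Section GaussianFunctional.
Variable R : rcfType.
Implicit Types p q : {poly R}.

(** Moments [1, 0, 1, 0, 3, ...] of the standard normal law. The recursion is integration by parts,
    so that everything stays algebraic. *)
Fixpoint gauss_moment (k : nat) : R :=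
  match k with
  | 0 => 1
  | 1 => 0
  | j.+2 => j.+1%:R * gauss_moment j
  end.

Definition gauss p : R := \sum_(i < size p) p`_i * gauss_moment i.

Lemma gauss_wide n p : (size p <= n)%N ->
  gauss p = \sum_(i < n) p`_i * gauss_moment i.
Proof.
move=> lepn; rewrite /gauss (big_ord_widen n (fun i => p`_i * gauss_moment i)) //.
rewrite big_mkcond /=; apply: eq_bigr => i _; case: ltnP => // lpi.
by rewrite nth_default ?mul0r.
Qed.

Lemma gauss_is_linear : linear_for *%R gauss.
Proof.
move=> c p q.
pose n := maxn (size (c *: p + q)) (maxn (size p) (size q)).
rewrite !(@gauss_wide n) ?leq_max ?leqnn ?orbT // mulr_sumr -big_split /=.
by apply: eq_bigr => i _; rewrite coefD coefZ mulrDl mulrA.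
Qed.

HB.instance Definition _ :=
  GRing.isLinear.Build R {poly R} R _ gauss gauss_is_linear.

Lemma gaussC c : gauss c%:P = c.
Proof. by rewrite (@gauss_wide 1) ?size_polyC_leq1 // big_ord1 coefC mulr1. Qed.

(** Stein's identity; on coefficients it is the recursion of the moments. *)
Lemma gauss_stein p : gauss ('X * p) = gauss p^`().
Proof.
rewrite (@gauss_wide (size p).+2); last first.
  by apply: leq_trans (size_polyMleq _ _) _; rewrite size_polyX.
rewrite (@gauss_wide (size p)); last first.
  exact: leq_trans (size_poly _ _) (leq_pred _).
rewrite 2!big_ord_recl /= !coefXM /= mul0r mulr0 !add0r.
apply: eq_bigr => i _; rewrite /bump /= !add1n coefXM /= coef_deriv.
by rewrite -mulr_natl; ring.
Qed.

(** The probabilists' Hermite polynomials. By Stein's identity, the operator [X p - p'] that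
    generates them is adjoint to derivation with respect to [gauss]. *)
Fixpoint hermite n : {poly R} :=
  if n is k.+1 then 'X * hermite k - (hermite k)^`() else 1.

Lemma gauss_hermite n p : gauss (hermite n * p) = gauss p^`(n).
Proof.
elim: n p => [|n IHn] p; first by rewrite mul1r.
rewrite /= mulrBl raddfB /= -mulrA gauss_stein derivM raddfD /= addrAC subrr.
by rewrite add0r IHn -derivSn.
Qed.

Lemma hermite_monic_size n : hermite n \is monic /\ size (hermite n) = n.+1.
Proof.
elim: n => [|n [mH sH]] /=; first by rewrite monic1 size_poly1.
have sXH : size ('X * hermite n) = n.+2.
  by rewrite mulrC size_mulX ?sH // monic_neq0.
have sd : (size (- (hermite n)^`())%R < size ('X * hermite n)%R)%N.
  by rewrite sXH size_polyN ltnS ltnW // -sH lt_size_deriv ?monic_neq0.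
rewrite monicE lead_coefDl // size_polyDl // sXH; split=> //.
by rewrite lead_coef_Mmonic ?lead_coefX.
Qed.

Lemma hermite_monic n : hermite n \is monic.
Proof. by case: (hermite_monic_size n). Qed.

Lemma size_hermite n : size (hermite n) = n.+1.
Proof. by case: (hermite_monic_size n). Qed.

Lemma hermite_orthogonal n p : (size p <= n)%N -> gauss (hermite n * p) = 0.
Proof. by move=> lepn; rewrite gauss_hermite derivn_poly0 ?raddf0. Qed.

Lemma gauss_hermite_sqr n : gauss (hermite n * hermite n) = n`!%:R.
Proof.
rewrite gauss_hermite (_ : _^`(n) = n`!%:R%:P) ?gaussC //.
apply/polyP => i; rewrite coef_derivn coefC.
case: i => [|i] /=.
  have := monicP (hermite_monic n); rewrite lead_coefE size_hermite /= addn0 => ->.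
  by rewrite ffactnn.
by rewrite nth_default ?mul0rn // size_hermite addnS ltnS leq_addr.
Qed.

(** Induction on the degree: removing the multiple of [hermite n] with the same leading term leaves
    a remainder [r] orthogonal to [hermite n]. The cross term disappears and [c ^ 2 n!] plus the
    value at [r ^ 2] remains. *)
Lemma gauss_sqr_gt0 p : p != 0 -> 0 < gauss (p * p).
Proof.
move: {2}(size p) (leqnn (size p)) => n; elim: n p => [|n IHn] p.
  by rewrite size_poly_leq0 => ->.
move=> lpn pn0; case: (ltngtP (size p) n.+1) lpn => // [ltp _|sp _].
  exact: IHn.
pose c := lead_coef p; pose r := p - c *: hermite n.
have c0 : c != 0 by rewrite lead_coef_eq0.
have sr : (size r <= n)%N.
  apply/leq_sizeP => j; rewrite leq_eqVlt coefB coefZ => /predU1P[<-|ltnj].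
    have := monicP (hermite_monic n); rewrite lead_coefE size_hermite /= => ->.
    by rewrite /c lead_coefE sp mulr1 subrr.
  by rewrite !nth_default ?mulr0 ?subrr ?size_hermite ?sp.
have -> : p * p = (c ^+ 2) *: (hermite n * hermite n)
    + (2 * c) *: (hermite n * r) + r * r.
  rewrite -[p in LHS](subrK (c *: hermite n)) -/r -!mul_polyC.
  by rewrite rmorphXn rmorphM rmorph_nat /=; ring.
rewrite !raddfD /= !linearZ /= (hermite_orthogonal sr) gauss_hermite_sqr mulr0 addr0.
have c2 : 0 < c ^+ 2 * n`!%:R.
  by rewrite mulr_gt0 ?ltr0n ?fact_gt0 // exprn_even_gt0.
have [->|r0] := eqVneq r 0; first by rewrite mulr0 raddf0 addr0.
by rewrite addr_gt0 ?IHn.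
Qed.

(* With [q] the quadratic factor, [h] would have degree less than [n], so that
   [gauss (hermite n * h) = gauss (q * h ^ 2)] would be both zero and positive. *)
Lemma hermite_no_real_pair n (a b : R) (h : {poly R}) :
  hermite n <> ((('X - a%:P) ^+ 2 + (b ^+ 2)%:P) * h).
Proof.
move=> He.
have h0 : h != 0.
  apply: contraTneq (monic_neq0 (hermite_monic n)) => h0.
  by rewrite He h0 mulr0 eqxx.
have q2 : size (('X - a%:P) ^+ 2 + (b ^+ 2)%:P) = 3.
  rewrite size_polyDl ?size_exp_XsubC //.
  by rewrite (leq_ltn_trans (size_polyC_leq1 _)).
have sh : (size h <= n)%N.
  have := size_hermite n; rewrite He size_mul // -?size_poly_gt0 ?q2 //=.
  by move=> [<-]; rewrite leqnSn.
have := hermite_orthogonal sh; rewrite He.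
have -> : (('X - a%:P) ^+ 2 + (b ^+ 2)%:P) * h * h
   = (('X - a%:P) * h) * (('X - a%:P) * h) + b ^+ 2 *: (h * h).
  by rewrite -mul_polyC; ring.
move/eqP; rewrite raddfD /= linearZ /= gt_eqF // ltr_wpDr //.
  by rewrite mulr_ge0 ?sqr_ge0 // ltW // gauss_sqr_gt0.
by rewrite gauss_sqr_gt0 // mulf_neq0 // polyXsubC_eq0.
Qed.

(** After factoring over the complex numbers, a nonreal root or a double root would each yield a
    factor [(X - a) ^ 2 + b ^ 2], with [b = 0] in the second case, and no such factor exists. *)
Lemma hermite_roots n :
  {s : seq R | uniq s & hermite n = \prod_(z <- s) ('X - z%:P)}.
Proof.
pose f := real_complex R.
have [r Hr] := closed_field_poly_normal (map_poly f (hermite n)).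
rewrite lead_coef_map (monicP (hermite_monic n)) rmorph1 scale1r in Hr.
pose s := [seq complex.Re z | z <- r].
have rreal z : z \in r -> z = f (complex.Re z).
  case: z => a b /= zr; apply/eqP; rewrite eq_complex /= eqxx /=.
  apply/eqP; apply/eqP; apply: contraT => b0.
  have rt : root (map_poly f (hermite n)) (a +i* b)%C.
    by rewrite Hr root_prod_XsubC.
  pose q := ('X - a%:P) ^+ 2 + (b ^+ 2)%:P : {poly R}.
  have q2 : size q = 3.
    rewrite size_polyDl ?size_exp_XsubC //.
    by rewrite (leq_ltn_trans (size_polyC_leq1 _)).
  have qz : (map_poly f q).[(a +i* b)%C] = 0.
    rewrite /q rmorphD rmorphXn /= rmorphB /= map_polyX !map_polyC /= !hornerE.
    by apply/eqP; rewrite eq_complex /=; apply/andP; split; apply/eqP; ring.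
  have := rt; rewrite {1}(divp_eq (hermite n) q) rmorphD rmorphM /= rootE.
  rewrite hornerD hornerM qz mulr0 add0r => /eqP rz.
  (* The remainder is real of degree at most 1 and vanishes at the nonreal point [a + i b]; hence it
     is zero and [q] divides [hermite n]. *)
  pose t := hermite n %% q.
  have st : (size t <= 2)%N by have := ltn_modpN0 (hermite n) (_ : q != 0); rewrite -/t q2 -size_poly_gt0 q2; apply.
  have te : t = t`_1 *: 'X + (t`_0)%:P.
    apply/polyP => i; rewrite coefD coefZ coefX coefC.
    case: i => [|[|i]] /=; rewrite ?mulr0 ?add0r ?mulr1 ?addr0 //.
    by rewrite nth_default // (leq_trans st).
  move: rz; rewrite -/t te rmorphD /= -mul_polyC rmorphM /= map_polyX !map_polyC /=.
  rewrite !hornerE => /eqP; rewrite eq_complex /= => /andP[/eqP re /eqP im].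
  have t1 : t`_1 = 0.
    by apply/eqP; move/eqP: im; rewrite mul0r !addr0 mulf_eq0 (negPf b0) orbF.
  have t0 : t`_0 = 0 by move: re; rewrite t1 !mul0r subr0 add0r.
  have := divp_eq (hermite n) q; rewrite -/t te t1 t0 scale0r !addr0 mulrC.
  by move/hermite_no_real_pair.
have Hs : hermite n = \prod_(z <- s) ('X - z%:P).
  apply: (map_poly_inj f); rewrite Hr rmorph_prod /= big_map.
  rewrite big_seq [RHS]big_seq; apply: eq_bigr => z /rreal zE.
  by rewrite {1}zE rmorphB /= map_polyX map_polyC.
exists s => //.
apply: contraT => /(uniqPn 0)[i [j [ij js eij]]].
pose z := s`_i.
have : hermite n = (('X - z%:P) ^+ 2 + (0 ^+ 2)%:P) *
   (\prod_(k < size s | (k != i :> nat) && (k != j :> nat)) ('X - (s`_k)%:P)).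
  rewrite Hs (big_nth 0) big_mkord.
  rewrite (bigD1 (Ordinal (ltn_trans ij js))) //=.
  rewrite (bigD1 (Ordinal js)) /=; last by rewrite -val_eqE /= gtn_eqF.
  by rewrite -eij -/z !expr2 mulr0 addr0 mulrA.
by move/hermite_no_real_pair.
Qed.

(** The nodes are the roots of [hermite n] and the weights are the integrals of the Lagrange
    polynomials. Up to degree [2n - 1], the quotient by [hermite n] has degree below [n] and is
    killed by orthogonality, while the remainder is interpolated exactly. *)
Lemma gauss_quadrature n :
  {s : seq (R * R) | all (fun t => 0 <= t.1) s &
   forall p, (size p <= n.*2)%N ->
     gauss p = \sum_(t <- s) t.1 * p.[t.2]}.
Proof.
have [z uz Hz] := hermite_roots n.
have sz : size z = n.
  by have := size_hermite n; rewrite Hz size_prod_XsubC => -[].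
pose l (i : 'I_n) := (\prod_(j < n | j != i) (z`_i - z`_j)^-1) *:
                     \prod_(j < n | j != i) ('X - (z`_j)%:P).
have ll (i j : 'I_n) : (l i).[z`_j] = (i == j)%:R.
  rewrite /l hornerZ horner_prod; have [<-|nij] := eqVneq i j.
    rewrite -big_split /= big1 // => k ki; rewrite !hornerE mulVf // subr_eq0.
    by rewrite nth_uniq ?sz // eq_sym.
  rewrite [X in _ * X](bigD1 j) /=; last by rewrite eq_sym.
  by rewrite !hornerE subrr /= !(mul0r, mulr0).
have sl (i : 'I_n) : (size (l i) <= n)%N.
  rewrite (leq_trans (size_scale_leq _ _)) //.
  rewrite (leq_trans (size_prod_leq _ _)) //=.
  rewrite (eq_bigr (fun=> 2%N)) => [|j _]; last by rewrite size_XsubC.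
  rewrite sum_nat_const muln2 -addnn -addSn addnK.
  rewrite (eq_card (B := predC1 i)) // cardC1 card_ord prednK //.
  exact: leq_ltn_trans (leq0n i) (ltn_ord i).
have interp p : (size p <= n)%N -> p = \sum_(i < n) p.[z`_i] *: l i.
  move=> sp; apply/eqP; rewrite -subr_eq0; apply/eqP.
  apply: (roots_geq_poly_eq0 _ uz); last first.
    rewrite sz (leq_trans (size_polyD _ _)) // geq_max sp size_polyN.
    rewrite (leq_trans (size_sum _ _ _)) //; apply/bigmax_leqP => i _.
    by rewrite (leq_trans (size_scale_leq _ _)).
  apply/allP => x /(nthP 0)[j]; rewrite sz => ltj <-.
  rewrite rootE hornerD hornerN horner_sum (bigD1 (Ordinal ltj)) //=.
  rewrite hornerZ (ll _ (Ordinal ltj)) eqxx mulr1 big1 ?addr0 ?subrr // => i ni.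
  by rewrite hornerZ (ll _ (Ordinal ltj)) (negPf ni) mulr0.
pose s := [seq (gauss (l i), z`_i) | i <- enum 'I_n].
have quad p : (size p <= n.*2)%N -> gauss p = \sum_(t <- s) t.1 * p.[t.2].
  move=> sp; rewrite big_map big_enum /=.
  have Hmon := hermite_monic n.
  rewrite {1}(divp_eq p (hermite n)) raddfD /= mulrC hermite_orthogonal ?add0r.
    rewrite {1}(interp (p %% hermite n)).
      rewrite raddf_sum /=; apply: eq_bigr => i _; rewrite linearZ /= mulrC.
      congr (_ * _); rewrite [in RHS](divp_eq p (hermite n)) hornerD hornerM.
      suff -> : (hermite n).[z`_i] = 0 by rewrite mulr0 add0r.
      by apply/rootP; rewrite Hz root_prod_XsubC mem_nth ?sz.
    by rewrite -ltnS -(size_hermite n) ltn_modp monic_neq0.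
  by rewrite size_divp ?monic_neq0 // size_hermite leq_subLR addnn.
exists s => //; apply/allP => t /mapP[i _ ->] /=.
(* The square of [l i] is within the range of exactness, equals 1 at its own node and 0 at the
   others, so its integral is the weight itself. *)
have : 0 <= gauss (l i * l i).
  by rewrite ltW // gauss_sqr_gt0 //; apply: contra_eqN (ll i i) => /eqP->;
     rewrite horner0 eqxx eq_sym oner_eq0.
rewrite quad; last first.
  rewrite (leq_trans (size_polyMleq _ _)) // -addnn -subn1 leq_subLR.
  by rewrite (leq_trans (leq_add (sl i) (sl i))) ?leq_addl.
rewrite big_map big_enum /= (bigD1 i) //= hornerM ll eqxx !mulr1 big1 ?addr0 //.
by move=> j ni; rewrite hornerM ll eq_sym (negPf ni) !mulr0.
Qed.

End GaussianFunctional.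

(** * Hilbert's identity from products of quadratures *)

Section HilbertIdentity.
Variable R : rcfType.

Lemma gauss_quadrature_moments N :
  {s : seq (R * R) | all (fun t => 0 <= t.1) s &
   forall k, (k < N.*2)%N -> \sum_(t <- s) t.1 * t.2 ^+ k = gauss_moment R k}.
Proof.
have [s s_ge0 sq] := gauss_quadrature R N; exists s => // k ltk.
have -> : gauss_moment R k = gauss ('X^k : {poly R}).
  rewrite (@gauss_wide _ k.+1) ?size_polyXn // big_ord_recr /= coefXn eqxx mul1r.
  rewrite big1 ?add0r // => i _; rewrite coefXn.
  by rewrite ltn_eqF ?ltn_ord // mul0r.
rewrite sq ?size_polyXn //; apply: eq_bigr => t _; by rewrite hornerXn.
Qed.

(** Stein's identity for [(u + X x) ^ k.+1] only involves moments up to order [k.+2], all matched by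
    the quadrature. The parameters [u] and [x] live in an algebra so that the identity can be used
    one coordinate at a time. *)
Lemma gauss_quadrature_stein N :
  {s : seq (R * R) | all (fun t => 0 <= t.1) s /\
    ((0 < N)%N -> \sum_(t <- s) t.1 = 1) &
   forall (A : comAlgType R) (u x : A) k, (k.+2 < N.*2)%N ->
     \sum_(t <- s) t.1 *: ((t.2 *: x) * (u + t.2 *: x) ^+ k.+1) =
     k.+1%:R *: (x ^+ 2 * \sum_(t <- s) t.1 *: (u + t.2 *: x) ^+ k)}.
Proof.
have [s s_ge0 sq] := gauss_quadrature_moments N; exists s.
  split=> // N0; have := sq 0%N; rewrite double_gt0 => /(_ N0) /= <-.
  by apply: eq_bigr => t _; rewrite mulr1.
move=> A u x k ltk.
have expand j (y : A) (e : nat) : (e + j < N.*2)%N ->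
  \sum_(t <- s) t.1 *: ((t.2 ^+ e *: y) * (u + t.2 *: x) ^+ j) =
  \sum_(i < j.+1) ('C(j, i)%:R * gauss_moment R (e + i)) *:
     (y * u ^+ (j - i) * x ^+ i).
  move=> ltj; under eq_bigr => t _ do rewrite exprDn mulr_sumr scaler_sumr.
  rewrite exchange_big /=; apply: eq_bigr => i _.
  rewrite -sq; last by rewrite (leq_ltn_trans _ ltj) // leq_add2l -ltnS ltn_ord.
  rewrite mulr_sumr scaler_suml; apply: eq_bigr => t _.
  rewrite exprZn -scaler_nat -2!scalerAr -scalerAl -scalerAr !scalerA mulrA exprD.
  by congr (_ *: _); ring.
rewrite (eq_bigr (fun t => t.1 *: ((t.2 ^+ 1 *: x) * (u + t.2 *: x) ^+ k.+1))) //.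
rewrite expand; last by rewrite add1n.
under [in RHS]eq_bigr => t _ do rewrite -[(u + _) ^+ k]mul1r -[1]scale1r -[1](expr0 t.2).
rewrite expand; last by rewrite add0n (ltnW (ltnW ltk)).
(* The term of index 0 carries the first moment, which is 0. The others match by the moment
   recursion and [(i+1) C(k+1, i+1) = (k+1) C(k, i)]. *)
rewrite big_ord_recl /= !mulr0 scale0r add0r mulr_sumr scaler_sumr.
apply: eq_bigr => i _; rewrite /bump /= !add1n add0n.
rewrite -scalerAr scalerA subSS; congr (_ *: _).
  rewrite mulrA -natrM mulnC -mul_bin_diag /= natrM; ring.
by rewrite !exprS; ring.
Qed.

(** The product of the quadratures, one factor for each member of [xs]. The free translation [u]
    absorbs the coordinates that are held fixed while Stein's identity is applied to another one. *)
Lemma stein_family n N (xs : seq {mpoly R[n]}) :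
  all (fun x => x \is 1.-homog) xs -> (0 < N)%N ->
  {s : seq (R * {mpoly R[n]}) |
    all (fun t => (0 <= t.1) && (t.2 \is 1.-homog)) s /\
    \sum_(t <- s) t.1 = 1 &
   forall (u : {mpoly R[n]}) k, (k.+2 < N.*2)%N ->
     \sum_(t <- s) t.1 *: (t.2 * (u + t.2) ^+ k.+1) =
     k.+1%:R *: ((\sum_(x <- xs) x ^+ 2) * \sum_(t <- s) t.1 *: (u + t.2) ^+ k)}.
Proof.
move=> + N0; elim: xs => [_|x xs IHxs /= /andP[hx /IHxs[s [sh s1] ss]]].
  exists [:: (1, 0)]; first by rewrite /= ler01 dhomog0 big_seq1.
  by move=> u k _; rewrite big_nil !big_seq1 /= !mul0r !scaler0.
have [q [q_ge0 q1] qs] := gauss_quadrature_stein N.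
exists [seq (t.1 * z.1, t.2 + z.2 *: x) | t <- s, z <- q].
  split.
    apply/allP => y /allpairsP[[t z] /= [/(allP sh) /andP[t0 ht]]].
    move=> /(allP q_ge0) z0 -> /=.
    by rewrite mulr_ge0 // dhomogD // dhomogZ.
  rewrite big_allpairs_dep /=.
  by under eq_bigr => t _ do rewrite -mulr_sumr q1 // mulr1.
move=> u k ltk; rewrite !big_allpairs_dep /= big_cons.
have Ex : \sum_(t <- s) \sum_(z <- q) (t.1 * z.1) *:
      ((z.2 *: x) * (u + (t.2 + z.2 *: x)) ^+ k.+1) =
    k.+1%:R *: (x ^+ 2 * \sum_(t <- s) \sum_(z <- q)
      (t.1 * z.1) *: (u + (t.2 + z.2 *: x)) ^+ k).
  rewrite mulr_sumr scaler_sumr; apply: eq_bigr => t _.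
  transitivity (t.1 *: (k.+1%:R *: (x ^+ 2 *
      \sum_(z <- q) z.1 *: (u + t.2 + z.2 *: x) ^+ k))).
    rewrite -(qs _ (u + t.2) x k ltk) scaler_sumr.
    by apply: eq_bigr => z _; rewrite addrA scalerA.
  rewrite scalerA mulrC -scalerA; congr (_ *: _).
  rewrite scalerAr scaler_sumr; congr (_ * _).
  by apply: eq_bigr => z _; rewrite addrA scalerA.
have Es : \sum_(t <- s) \sum_(z <- q) (t.1 * z.1) *:
      (t.2 * (u + (t.2 + z.2 *: x)) ^+ k.+1) =
    k.+1%:R *: ((\sum_(x <- xs) x ^+ 2) * \sum_(t <- s) \sum_(z <- q)
      (t.1 * z.1) *: (u + (t.2 + z.2 *: x)) ^+ k).
  rewrite exchange_big [in RHS]exchange_big /= mulr_sumr scaler_sumr.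
  apply: eq_bigr => z _.
  transitivity (z.1 *: (k.+1%:R *: ((\sum_(x <- xs) x ^+ 2) *
      \sum_(t <- s) t.1 *: (u + z.2 *: x + t.2) ^+ k))).
    rewrite -(ss (u + z.2 *: x) k ltk) scaler_sumr.
    by apply: eq_bigr => t _; rewrite addrA addrAC scalerA mulrC.
  rewrite scalerA mulrC -scalerA; congr (_ *: _).
  rewrite scalerAr scaler_sumr; congr (_ * _).
  by apply: eq_bigr => t _; rewrite addrA addrAC scalerA mulrC.
rewrite mulrDl scalerDr -Ex -Es -big_split /=; apply: eq_bigr => t _.
rewrite -big_split /=; apply: eq_bigr => z _.
by rewrite mulrDl scalerDr addrC.
Qed.

(** At [u = 0] the Stein identity raises the exponent by two at the price of a factor [(2j+1) S], so
    [c] is the product of the odd numbers below [2r]. *)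
Lemma hilbert_identity n r :
  {s : seq (R * {mpoly R[n]}) &
   {c : R | all (fun t => (0 <= t.1) && (t.2 \is 1.-homog)) s /\ 0 < c &
    \sum_(t <- s) t.1 *: t.2 ^+ r.*2 = c *: (\sum_(i < n) 'X_i ^+ 2) ^+ r}}.
Proof.
have [|s [sh s1] ss] := @stein_family n r.+1 [seq 'X_i | i <- enum 'I_n] _ isT.
  by apply/allP => _ /mapP[i _ ->]; rewrite dhomogX /= mdeg1.
have {}ss j : (j <= r)%N -> 
  {c | 0 < c & \sum_(t <- s) t.1 *: t.2 ^+ j.*2 = c *: (\sum_(i < n) 'X_i ^+ 2) ^+ j}.
  elim: j => [_|j IHj /[dup] ltj /ltnW /IHj [c c0 Ec]].
    by exists 1 => //; rewrite -scaler_suml s1.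
  exists (j.*2.+1%:R * c); first by rewrite mulr_gt0 ?ltr0n.
  transitivity (\sum_(t <- s) t.1 *: (t.2 * (0 + t.2) ^+ j.*2.+1)).
    by apply: eq_bigr => t _; rewrite add0r -exprS doubleS.
  rewrite ss; last by rewrite doubleS !ltnS ltn_double.
  rewrite big_map big_enum /= (eq_bigr (fun t => t.1 *: t.2 ^+ j.*2)).
    by rewrite Ec -scalerAr scalerA exprS.
  by move=> t _; rewrite add0r.
by have [c c0 Ec] := ss r (leqnn r); exists s, c.
Qed.

End HilbertIdentity.

(** * Bounds on coefficients, and partial derivatives of forms *)

Section CoefficientBounds.
Context {R : realFieldType} {n : nat}.
Implicit Types (p q G : {mpoly R[n]}) (m : 'X_{1..n}) (K C : R).

Definition coef_bounded K p := forall m, `|p@_m| <= K.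

Lemma coef_bounded_le K C p : K <= C -> coef_bounded K p -> coef_bounded C p.
Proof. by move=> KC bp m; apply: le_trans (bp m) KC. Qed.

Lemma coef_bounded0 : coef_bounded 0 0.
Proof. by move=> m; rewrite mcoeff0 normr0. Qed.

Lemma coef_boundedD K C p q :
  coef_bounded K p -> coef_bounded C q -> coef_bounded (K + C) (p + q).
Proof.
by move=> bp bq m; rewrite mcoeffD (le_trans (ler_normD _ _)) // lerD.
Qed.

Lemma coef_boundedZ K c p : coef_bounded K p -> coef_bounded (`|c| * K) (c *: p).
Proof. by move=> bp m; rewrite mcoeffZ normrM ler_wpM2l. Qed.

Lemma coef_bounded_sum (I : Type) (r : seq I) K (F : I -> {mpoly R[n]}) :
  (forall i, coef_bounded K (F i)) ->
  coef_bounded ((size r)%:R * K) (\sum_(i <- r) F i).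
Proof.
move=> bF; elim: r => [|i r IHr]; first by rewrite big_nil mul0r; exact: coef_bounded0.
by rewrite big_cons -natr1 mulrDl mul1r addrC; apply: coef_boundedD.
Qed.

Lemma coef_boundedMX K p m : 0 <= K ->
  coef_bounded K p -> coef_bounded K (p * 'X_[m]).
Proof.
move=> K0 bp k; have [mk|nmk] := boolP (m <= k)%MM.
  by rewrite -(submK mk) addmC mcoeffMX.
rewrite memN_msupp_eq0 ?normr0 // (perm_mem (msuppMX p m)).
by apply: contra nmk => /mapP[m' _ ->]; rewrite lem_addr.
Qed.

Lemma coef_boundedX m : coef_bounded 1 'X_[m].
Proof. by move=> k; rewrite mcoeffX; case: eqP; rewrite ?normr1 ?normr0 ?ler01. Qed.

Lemma coef_bounded_ge0 K p : coef_bounded K p -> 0 <= K.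
Proof. by move=> /(_ 0%MM); apply: le_trans. Qed.

Lemma coef_bounded_ex p : {K | 0 <= K & coef_bounded K p}.
Proof.
exists (\sum_(m <- msupp p) `|p@_m|); first exact: sumr_ge0.
move=> m; have [mp|/memN_msupp_eq0->] := boolP (m \in msupp p).
  by rewrite (big_rem m) //= lerDl sumr_ge0.
by rewrite normr0 sumr_ge0.
Qed.

Lemma coef_bounded_mderiv d K p i : (forall m, m \in msupp p -> (mdeg m <= d)%N) ->
  coef_bounded K p -> coef_bounded (d%:R * K) p^`M(i).
Proof.
move=> dp bp m; rewrite mcoeff_deriv; have K0 := coef_bounded_ge0 bp.
have [mp|/memN_msupp_eq0->] := boolP ((m + U_(i))%MM \in msupp p); last first.
  by rewrite mul0rn normr0 mulr_ge0.
rewrite -[_ *+ (m i).+1]mulr_natl normrM normr_nat ler_pM // ler_nat.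
apply: leq_trans (dp _ mp); rewrite mdegD mdeg1 addn1 ltnS mdegE (bigD1 i) //=.
exact: leq_addr.
Qed.

Lemma dhomog_mderiv d p i : p \is d.+1.-homog -> p^`M(i) \is d.-homog.
Proof.
move=> /dhomogP hp; apply/dhomogP => m; rewrite mcoeff_msupp mcoeff_deriv => h.
have: (m + U_(i))%MM \in msupp p.
  by rewrite mcoeff_msupp; apply: contraNneq h => ->; rewrite mul0rn.
by move/hp; rewrite /= mdegD mdeg1 addn1 => -[].
Qed.

Lemma dhomog0_mderiv p i : p \is 0.-homog -> p^`M(i) = 0.
Proof.
move=> /dhomog_nemf_coeff hp; apply/mpolyP => m.
by rewrite mcoeff_deriv hp ?mul0rn ?mcoeff0 //= mdegD mdeg1 addn1.
Qed.

Lemma mderiv_exp p k i : (p ^+ k.+1)^`M(i) = k.+1%:R *: (p ^+ k * p^`M(i)).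
Proof.
elim: k => [|k IHk]; first by rewrite expr1 scale1r mul1r.
rewrite exprS mderivM IHk -scalerAr mulrA -exprS mulrC.
by rewrite -[in RHS]natr1 scalerDl scale1r addrC.
Qed.

Lemma mdegS m d : mdeg m = d.+1 -> {i & {m' | mdeg m' = d & m = (m' + U_(i))%MM}}.
Proof.
move=> dm; have [i mi|m0] := pickP (fun i => m i != 0%N); last first.
  by move: dm; rewrite mdegE big1 // => i _; apply/eqP; have := m0 i => /= /negbFE.
have le1m : (U_(i) <= m)%MM by rewrite lep1mP.
exists i, (m - U_(i))%MM; last by rewrite submK.
by apply/eqP; rewrite -eqSS -dm -[in X in _ == X](submK le1m) mdegD mdeg1 addn1.
Qed.

End CoefficientBounds.

(** * Iterated derivatives of the powers of [S] *)

Section PolarDerivatives.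
Context {R : realFieldType} {n : nat}.
Implicit Types (p q h l G : {mpoly R[n]}) (m : 'X_{1..n}) (K C : R).

Definition sumsq : {mpoly R[n]} := \sum_(i < n) 'X_i ^+ 2.

Lemma sumsq_homog : sumsq \is 2.-homog.
Proof.
apply: rpred_sum => i _; apply: (@dhomogMn _ _ _ 1 'X_i 2).
by rewrite dhomogX /= mdeg1.
Qed.

Lemma mderiv_sumsq i : sumsq^`M(i) = 2 *: 'X_i.
Proof.
rewrite /sumsq raddf_sum /= (bigD1 i) //= big1 ?addr0.
  have U0 : (U_(i) - U_(i) = 0 :> 'X_{1..n})%MM.
    by apply/mnmP => j; rewrite mnmBE subnn mnm0E.
  by rewrite mderiv_exp expr1 mderivX mnm1E eqxx scale1r U0 mpolyX0 mulr1.
move=> j ji; rewrite mderiv_exp mderivX mnm1E (negPf ji) scale0r.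
by rewrite mulr0 scaler0.
Qed.

Lemma coef_bounded_sumsqM K p : 0 <= K ->
  coef_bounded K p -> coef_bounded (n%:R * K) (sumsq * p).
Proof.
move=> K0 bp; rewrite /sumsq mulr_suml -big_enum /=.
have := @coef_bounded_sum R n _ (enum 'I_n) K (fun i => 'X_i ^+ 2 * p).
rewrite size_enum_ord; apply => i.
by rewrite mulrC expr2 mulrA; do 2!apply: coef_boundedMX => //.
Qed.

(* [G] stands for a form of degree [d - 2], which has to vanish when [d < 2]. *)
Definition lower_homog d G : bool :=
  if d is e.+2 then G \is e.-homog else G == 0.

Lemma lower_homog_msupp d G : lower_homog d G ->
  forall m, m \in msupp G -> (mdeg m <= d)%N.
Proof.
case: d => [|[|d]] /=; try by move=> /eqP-> m; rewrite msupp0.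
by move=> /dhomogP hG m /hG /= ->; rewrite ltnW.
Qed.

Lemma lower_homogD d G G' :
  lower_homog d G -> lower_homog d G' -> lower_homog d (G + G').
Proof.
case: d => [|[|d]] /=; try by move=> /eqP-> /eqP->; rewrite addr0.
exact: dhomogD.
Qed.

Lemma lower_homogZ d c G : lower_homog d G -> lower_homog d (c *: G).
Proof.
case: d => [|[|d]] /=; try by move=> /eqP->; rewrite scaler0.
exact: dhomogZ.
Qed.

Lemma lower_homog0 d : lower_homog d 0.
Proof. by case: d => [|[|d]] //=; apply: dhomog0. Qed.

Lemma mderivm_sumsq d : exists2 C, 0 <= C & forall m, mdeg m = d -> forall s,
  exists G, [/\ lower_homog d G, coef_bounded (C / s.+1%:R) G
   & (sumsq ^+ (s + d))^`M[m] = ((s + d) ^_ d)%:R *: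
     (2 ^+ d *: (sumsq ^+ s * 'X_[m]) + sumsq ^+ s.+1 * G)].
Proof.
elim: d => [|d [C C0 IHd]].
  exists 0 => // m /eqP; rewrite mdeg_eq0 => /eqP-> s; exists 0; split=> //=.
    by rewrite mul0r; apply: coef_bounded0.
  by rewrite mderivm0m addn0 ffactn0 mpolyX0 mulr1 mulr0 addr0 !scale1r.
exists (2 ^+ d * d%:R + 2 * C + n%:R * (d%:R * C)).
  by rewrite !addr_ge0 // !mulr_ge0 // exprn_ge0.
move=> m /mdegS[i [m' dm' ->]] s.
have [G [hG bG EG]] := IHd m' dm' s.+1.
(* The terms other than the main one, divided by the extracted [s.+1]. They match the three summands
   of the constant; the factor [s.+2] is compensated by the bound [C / s.+2] on [G]. *)
pose G' := s.+1%:R^-1 *: (2 ^+ d *: ('X_[m'])^`M(i) +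
  (2 * s.+2%:R) *: (G * 'X_i) + sumsq * G^`M(i)).
have bG2 : coef_bounded C G.
  by apply: coef_bounded_le bG; rewrite ler_pdivrMr ?ltr0n // ler_peMr // ler1n.
exists G'; split.
- apply: lower_homogZ; rewrite !lower_homogD ?lower_homogZ //.
  + case: (d) dm' => [|e] dm' /=.
      by rewrite dhomog0_mderiv // dhomogX /= dm'.
    by rewrite dhomog_mderiv // dhomogX /= dm'.
  + case: (d) hG => [|[|e]] /= hG; try by rewrite (eqP hG) mul0r ?dhomog0.
    by rewrite -[e.+1]addn1 dhomogM // dhomogX /= mdeg1.
  + case: (d) hG => [|[|[|e]]] /= hG; try by rewrite (eqP hG) mderiv0 mulr0 ?dhomog0.
      by rewrite dhomog0_mderiv // mulr0 dhomog0.
    by rewrite -[e.+2]add2n dhomogM ?sumsq_homog // dhomog_mderiv.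
- rewrite mulrC; have -> : s.+1%:R^-1 = `|s.+1%:R^-1 : R|.
    by rewrite ger0_norm // invr_ge0.
  apply: coef_boundedZ; apply: coef_boundedD; first apply: coef_boundedD.
  + have -> : 2 ^+ d * d%:R = `|2 ^+ d : R| * (d%:R * 1).
      by rewrite mulr1 ger0_norm // exprn_ge0.
    apply/coef_boundedZ/coef_bounded_mderiv; last exact: coef_boundedX.
    by move=> k; rewrite msuppX inE => /eqP->; rewrite dm'.
  + have -> : 2 * C = `|2 * s.+2%:R : R| * (C / s.+2%:R).
      by rewrite ger0_norm ?mulr_ge0 // -mulrA [_ * (C / _)]mulrC divfK ?pnatr_eq0.
    by apply/coef_boundedZ/coef_boundedMX => //; rewrite divr_ge0.
  + apply: coef_bounded_sumsqM; first by rewrite mulr_ge0.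
    by apply: coef_bounded_mderiv => //; apply: lower_homog_msupp.
rewrite mderivmDm mderivmU1m addnS -addSn EG linearZ /= linearD /= linearZ /=.
have := mderiv_exp sumsq s i; have := mderiv_exp sumsq s.+1 i.
have := exprS sumsq s.+1; have := exprS sumsq s.
move: (sumsq ^+ s.+2) (sumsq ^+ s.+1) => P2 P1 P1E P2E D2 D1.
rewrite !mderivM D1 D2 P2E P1E !mderiv_sumsq ffactnSr addnK natrM -scalerA.
congr (_ *: _).
have cancel y z : s.+1%:R *: (y * (s.+1%:R^-1 *: z)) = y * z :> {mpoly R[n]}.
  by rewrite scalerAr scalerA divff ?pnatr_eq0 // scale1r.
rewrite /G' mpolyXD [in RHS]scalerDr cancel -!mul_mpolyC.
rewrite [(2 ^+ d.+1)]exprS.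
have -> : s.+2%:R = s.+1%:R + 1 :> R by rewrite natr1.
rewrite !mpolyCM !mpolyCD !mpolyC1.
by ring.
Qed.

End PolarDerivatives.

(** * Values of forms, and derivatives of powers of linear forms *)

Section HomogeneousBounds.
Context {R : realFieldType} {n : nat}.
Implicit Types (p q h l G : {mpoly R[n]}) (m : 'X_{1..n}) (K C : R).

Lemma size_msupp_dhomog d p : p \is d.-homog ->
  (size (msupp p) <= #|{: 'X_{1..n < d.+1}}|)%N.
Proof.
move=> /dhomogP hp; rewrite cardE -(size_map (@bmnm n d.+1)).
apply: uniq_leq_size => [|m mp]; first exact: msupp_uniq.
have dm : (mdeg m < d.+1)%N by rewrite -[mdeg m]/(mdeg m) (hp m mp).
by apply/mapP; exists (BMultinom dm); rewrite ?mem_enum.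
Qed.

Lemma mderiv_linear l i : l \is 1.-homog -> l^`M(i) = (l@_U_(i))%:MP.
Proof.
move=> /dhomog_nemf_coeff hl; apply/mpolyP => m; rewrite mcoeff_deriv mcoeffC.
have [->|m0] := eqVneq m 0%MM; first by rewrite mnm0E add0m mulr1.
by rewrite hl ?mul0rn ?mulr0 //= mdegD mdeg1 addn1 eqSS mdeg_eq0.
Qed.

(** Each derivative of a power of [l] brings out one coefficient of [l], so [h(D)] acts on such
    powers through the value of [h] at the coefficient vector. *)
Lemma mderivm_linear_exp d l m k : l \is 1.-homog -> mdeg m = d ->
  (l ^+ (k + d))^`M[m] =
  (((k + d) ^_ d)%:R * ('X_[m]).@[fun i => l@_U_(i)]) *: l ^+ k.
Proof.
move=> hl; elim: d m k => [|d IHd] m k.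
  move/eqP; rewrite mdeg_eq0 => /eqP->.
  by rewrite mderivm0m addn0 ffactn0 mpolyX0 meval1 mulr1 scale1r.
move=> /mdegS[i [m' dm' ->]].
rewrite mderivmDm mderivmU1m addnS -addSn IHd // mderivZ mderiv_exp.
rewrite mderiv_linear // mpolyXD mevalM mevalXU ffactnSr addnK natrM.
rewrite [_ * _%:MP]mulrC mul_mpolyC !scalerA; congr (_ *: _).
by ring.
Qed.

Lemma meval_sumsq (x : 'I_n -> R) : sumsq.@[x] = \sum_(i < n) x i ^+ 2.
Proof. by rewrite raddf_sum /=; apply: eq_bigr => i _; rewrite rmorphXn /= mevalXU. Qed.

Lemma meval_sumsq_ge0 (x : 'I_n -> R) : 0 <= sumsq.@[x].
Proof. by rewrite meval_sumsq sumr_ge0 // => i _; rewrite sqr_ge0. Qed.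

(** Squaring both sides reduces the claim to [x_i ^ 2 <= S(x)] and avoids square roots. *)
Lemma meval_monomial_bound m d (x : 'I_n -> R) :
  mdeg m = d.*2 -> `|('X_[m]).@[x]| <= sumsq.@[x] ^+ d.
Proof.
move=> dm; rewrite -(ler_pXn2r (n := 2)) ?nnegrE ?exprn_ge0 ?meval_sumsq_ge0 //.
rewrite real_normK ?num_real // -exprM muln2 -dm mdegE mevalX -prodrXl expr_sum.
apply: ler_prod => i _; rewrite exprAC exprn_ge0 ?sqr_ge0 //=.
rewrite lerXn2r ?nnegrE ?sqr_ge0 ?meval_sumsq_ge0 // meval_sumsq (bigD1 i) //=.
by rewrite lerDl sumr_ge0 // => j _; rewrite sqr_ge0.
Qed.

Lemma meval_bound d K p (x : 'I_n -> R) : p \is d.*2.-homog -> coef_bounded K p ->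
  `|p.@[x]| <= #|{: 'X_{1..n < d.*2.+1}}|%:R * K * sumsq.@[x] ^+ d.
Proof.
move=> hp bp; have K0 := coef_bounded_ge0 bp.
rewrite {1}[p]mpolyE raddf_sum /= (le_trans (ler_norm_sum _ _ _)) //.
apply: (@le_trans _ _ (\sum_(m <- msupp p) K * sumsq.@[x] ^+ d)).
  rewrite big_seq [X in _ <= X]big_seq; apply: ler_sum => m mp.
  rewrite mevalZ normrM ler_pM // meval_monomial_bound //.
  by move/dhomogP: hp => /(_ m mp).
rewrite big_const_seq count_predT iter_addr_0 -[X in X <= _]mulr_natl mulrA.
rewrite ler_wpM2r ?exprn_ge0 ?meval_sumsq_ge0 // ler_wpM2r // ler_nat.
exact: size_msupp_dhomog.
Qed.

(** The linear extension from monomials to [h(D)]. The list [ms] is arbitrary for the sake of the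
    induction and becomes the support of [h]. *)
Lemma polar_sumsq d : exists2 C, 0 <= C & forall ms h K s,
  all (fun m => mdeg m == d) ms -> coef_bounded K h ->
  exists G, [/\ lower_homog d G, coef_bounded ((size ms)%:R * (K * (C / s.+1%:R))) G
   & \sum_(m <- ms) h@_m *: (sumsq ^+ (s + d))^`M[m] = ((s + d) ^_ d)%:R *:
     (2 ^+ d *: (sumsq ^+ s * \sum_(m <- ms) h@_m *: 'X_[m]) + sumsq ^+ s.+1 * G)].
Proof.
have [C C0 HC] := @mderivm_sumsq R n d; exists C => // ms h K s + bh.
have K0 := coef_bounded_ge0 bh.
elim: ms => [_|m ms IHms /= /andP[/eqP dm /IHms[G [hG bG EG]]]].
  exists 0; split; first exact: lower_homog0.
    by rewrite mul0r; apply: coef_bounded0.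
  by rewrite !big_nil !mulr0 scaler0 addr0 scaler0.
have [Gm [hGm bGm EGm]] := HC m dm s.
exists (h@_m *: Gm + G); split.
- by rewrite lower_homogD // lower_homogZ.
- rewrite -natr1 mulrDl mul1r addrC; apply: coef_boundedD => //.
  apply: coef_bounded_le (coef_boundedZ _ bGm).
  by rewrite ler_wpM2r // divr_ge0.
rewrite !big_cons EG EGm -!mul_mpolyC; ring.
Qed.

End HomogeneousBounds.

(** * Nonnegative combinations of powers of linear forms *)

Section EvenPowerCone.
Context {R : rcfType} {n : nat}.
Implicit Types (p q h l G : {mpoly R[n]}) (m : 'X_{1..n}) (K C : R).

(** Weights stay separate from the linear forms, because [h(D)] rescales them; roots are extracted
    only at the end. *)
Definition power_cone k p : Prop :=
  exists2 s : seq (R * {mpoly R[n]}),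
    all (fun t => (0 <= t.1) && (t.2 \is 1.-homog)) s &
    p = \sum_(t <- s) t.1 *: t.2 ^+ k.

Lemma power_coneD k p q : power_cone k p -> power_cone k q -> power_cone k (p + q).
Proof.
move=> [s hs ->] [t ht ->]; exists (s ++ t); first by rewrite all_cat hs.
by rewrite big_cat.
Qed.

Lemma power_coneZ k c p : 0 <= c -> power_cone k p -> power_cone k (c *: p).
Proof.
move=> c0 [s /allP hs ->]; exists [seq (c * t.1, t.2) | t <- s].
  apply/allP => _ /mapP[t /hs /andP[t0 ht] ->] /=.
  by rewrite ht mulr_ge0.
by rewrite scaler_sumr big_map; apply: eq_bigr => t _; rewrite scalerA.
Qed.

Lemma power_cone_sumsq r : power_cone r.*2 (sumsq ^+ r).
Proof.
have [s [c [hs c0] Es]] := hilbert_identity R n r.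
rewrite -[_ ^+ r]scale1r -(mulVf (lt0r_neq0 c0)) -scalerA -[X in _ *: X]Es.
by apply: power_coneZ; [rewrite invr_ge0 ltW|exists s].
Qed.

(* Applying the differential operator [h(D)] to Hilbert's identity
   [sumsq ^ (s + d) = sum c_t l_t ^ (2 (s + d))] turns the right-hand side into a
   combination of the [l_t ^ (2 s + d)] with weights proportional to [h] evaluated at
   the coefficient vector of [l_t]. *)
Lemma polarized_hilbert d : exists2 C, 0 <= C & forall K h s,
  h \is d.-homog -> coef_bounded K h ->
  exists2 G, lower_homog d G /\ coef_bounded (C * K / s.+1%:R) G &
  exists2 u : seq (R * {mpoly R[n]}),
    all (fun t => (0 <= t.1) && (t.2 \is 1.-homog)) u &
    sumsq ^+ s * h + sumsq ^+ s.+1 * G =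
    \sum_(t <- u) (t.1 * h.@[fun i => t.2@_U_(i)]) *: t.2 ^+ (s.*2 + d).
Proof.
have [C C0 HC] := @polar_sumsq R n d.
pose D := #|{: 'X_{1..n < d.+1}}|.
exists (`|(2 ^+ d)^-1| * (D%:R * C)); first by rewrite !mulr_ge0.
move=> K h s hh bh; have K0 := coef_bounded_ge0 bh.
have dms : all (fun m => mdeg m == d) (msupp h).
  by apply/allP => m mh; apply/eqP; move/dhomogP: hh => /(_ m mh).
have [G [hG bG EG]] := HC (msupp h) h K s dms bh.
exists ((2 ^+ d)^-1 *: G); first (split; first exact: lower_homogZ).
  rewrite -!mulrA; apply: coef_boundedZ; apply: coef_bounded_le bG.
  rewrite [C * (K * _)]mulrCA ler_wpM2r ?ler_nat ?size_msupp_dhomog //.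
  by rewrite !mulr_ge0 // invr_ge0.
have [u [c [hu c0] Eu]] := hilbert_identity R n (s + d).
have f0 k : (0 : R) < ((k + d) ^_ d)%:R by rewrite ltr0n ffact_gt0 leq_addl.
(* The product of all constants: Hilbert's [c], the falling factorial and [2 ^ d] from
   differentiating the power of [S]. *)
pose e := c * ((s + d) ^_ d)%:R * 2 ^+ d.
have e0 : 0 < e by rewrite !mulr_gt0 ?exprn_gt0.
have -> : sumsq ^+ s * h + sumsq ^+ s.+1 * ((2 ^+ d)^-1 *: G) =
  e^-1 *: \sum_(m <- msupp h) h@_m *: (c *: sumsq ^+ (s + d))^`M[m].
  under eq_bigr => m _ do rewrite linearZ /= scalerA mulrC -scalerA.
  rewrite -scaler_sumr EG -mpolyE scalerA scalerDr scalerA.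
  rewrite -scalerAr [in RHS]scalerDr !scalerA.
  have F0 := lt0r_neq0 (f0 s); have c0' := lt0r_neq0 c0.
  have T0 : (2 : R) ^+ d != 0 by rewrite expf_neq0 // pnatr_eq0.
  rewrite -[X in X + _]scale1r /e.
  by congr (_ *: _ + _ *: _); field; rewrite F0 c0' T0.
rewrite /sumsq -Eu.
(* Deriving [l ^ (2 (s + d))] in total [d] times leaves [l ^ (2 s + d)] and this falling
   factorial. *)
exists [seq (e^-1 * (t.1 * ((s.*2 + d + d) ^_ d)%:R), t.2) | t <- u].
  apply/allP => _ /mapP[t /(allP hu) /andP[t0 ht] ->] /=.
  by rewrite ht andbT !mulr_ge0 ?invr_ge0 // ltW.
rewrite [RHS]big_map scaler_sumr.
transitivity (\sum_(m <- msupp h) \sum_(t <- u)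
    e^-1 *: (h@_m *: (t.1 *: t.2 ^+ (s + d).*2)^`M[m])).
  by apply: eq_bigr => m _; rewrite raddf_sum !scaler_sumr.
rewrite exchange_big [LHS]big_seq [RHS]big_seq; apply: eq_bigr => t /(allP hu) /andP[_ ht].
rewrite mevalE !mulr_sumr scaler_suml [LHS]big_seq [RHS]big_seq.
apply: eq_bigr => m /(allP dms) /eqP dm.
rewrite mderivmZ doubleD -(addnn d) addnA mderivm_linear_exp // mevalX !scalerA.
by congr (_ *: _); rewrite /=; ring.
Qed.

Lemma power_cone_polar d : exists2 C, 0 <= C & forall K h s,
  h \is d.-homog -> coef_bounded K h -> (forall x : 'I_n -> R, 0 <= h.@[x]) ->
  exists G, [/\ lower_homog d G, coef_bounded (C * K / s.+1%:R) G
   & power_cone (s.*2 + d) (sumsq ^+ s * h + sumsq ^+ s.+1 * G)].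
Proof.
have [C C0 HC] := polarized_hilbert d; exists C => // K h s hh bh h0.
have [G [hG bG] [u hu Eu]] := HC K h s hh bh; exists G; split=> //; rewrite Eu.
exists [seq (t.1 * h.@[fun i => t.2@_U_(i)], t.2) | t <- u]; last by rewrite big_map.
apply/allP => _ /mapP[t /(allP hu) /andP[t0 ht] ->] /=.
by rewrite ht andbT mulr_ge0.
Qed.

End EvenPowerCone.

(** * Reznick's theorem with a uniform exponent *)

Section UniformDenominators.
Context {R : realType} {n : nat}.
Implicit Types (g : {mpoly R[n]}).

(** The threshold depends on [g] only through [e] and [K]. This uniformity carries the induction,
    since the cofactor [F] to which the hypothesis is applied varies with [N]. *)
Lemma uniform_denominators m : forall e K : R, 0 < e -> exists N0, forall N, (N0 <= N)%N ->
  forall g, g \is m.*2.-homog -> coef_bounded K g ->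
  (forall x : 'I_n -> R, e * sumsq.@[x] ^+ m <= g.@[x]) ->
  power_cone (N + m).*2 (sumsq ^+ N * g).
Proof.
elim: m => [|m IHm] e K e0.
  exists 0%N => N _ g /dhomog_nemf_coeff hg _ ge.
  have gE : g = (g@_0%MM)%:MP.
    apply/mpolyP => k; rewrite mcoeffC.
    have [->|k0] := eqVneq k 0%MM; first by rewrite mulr1.
    by rewrite hg ?mulr0 //= mdeg_eq0.
  rewrite addn0 gE mulrC mul_mpolyC; apply: power_coneZ; last exact: power_cone_sumsq.
  have := ge (fun=> 0); rewrite mulr1 gE mevalC mcoeffC eqxx mulr1.
  exact/le_trans/ltW.
have [C C0 HC] := @power_cone_polar R n m.+1.*2.
have [KS KS0 bS] := coef_bounded_ex (sumsq ^+ m.+1 : {mpoly R[n]}).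
have [KT KT0 bT] := coef_bounded_ex (sumsq ^+ m : {mpoly R[n]}).
pose Kh := K + `|- (e / 2)| * KS.
pose D : R := #|{: 'X_{1..n < m.*2.+1}}|%:R.
have e2 : 0 < e / 2 by rewrite divr_gt0.
have e4 : 0 < e / 4 by rewrite divr_gt0.
have [N0 HN0] := IHm (e / 4) (`|e / 2| * KT + `|-1| * (C * Kh)) e4.
(* [D] bounds the number of monomials of [G] and [C * Kh / N.+1] their coefficients; beyond this
   threshold [G <= (e/4) S ^ m]. *)
exists (maxn N0 (Num.bound (D * (C * Kh) / (e / 4)))) => N.
rewrite geq_max => /andP[leN0 leN] g hg bg ge.
have K0 := coef_bounded_ge0 bg.
have Kh0 : 0 <= Kh by rewrite addr_ge0 // mulr_ge0.
have hS k : (sumsq ^+ k : {mpoly R[n]}) \is k.*2.-homog.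
  by rewrite -mul2n; apply/dhomogMn/sumsq_homog.
pose h := g + (- (e / 2)) *: sumsq ^+ m.+1.
have hh : h \is m.+1.*2.-homog by rewrite dhomogD // dhomogZ.
have bh : coef_bounded Kh h by apply/coef_boundedD/coef_boundedZ.
have Sx0 (x : 'I_n -> R) k : 0 <= sumsq.@[x] ^+ k.
  by rewrite exprn_ge0 // meval_sumsq_ge0.
have h0 (x : 'I_n -> R) : 0 <= h.@[x].
  rewrite mevalD mevalZ rmorphXn /= mulNr subr_ge0 (le_trans _ (ge x)) //.
  by rewrite ler_wpM2r //; lra.
have [G [hG bG coneG]] := HC Kh h N hh bh h0.
pose F := (e / 2) *: sumsq ^+ m + (-1) *: G.
have -> : sumsq ^+ N * g = sumsq ^+ N * h + sumsq ^+ N.+1 * G + sumsq ^+ N.+1 * F.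
  have E1 : sumsq ^+ N.+1 * sumsq ^+ m = sumsq ^+ N * sumsq ^+ m.+1 :> {mpoly R[n]}.
    by rewrite -!exprD addSnnS.
  rewrite /h /F !mulrDr -!scalerAr E1 scaleN1r scaleNr.
  by rewrite [_ - _ + _]addrAC addrA subrK addrK.
apply: power_coneD; first by rewrite doubleD.
rewrite -addSnnS; apply: HN0; first exact: leqW.
- by rewrite dhomogD // dhomogZ.
- apply: coef_boundedD; apply: coef_boundedZ => //; apply: coef_bounded_le bG.
  by rewrite ler_pdivrMr // ler_peMr ?ler1n // mulr_ge0.
move=> x; rewrite mevalD !mevalZ rmorphXn /= mulN1r.
suff Gx : G.@[x] <= e / 4 * sumsq.@[x] ^+ m.
  rewrite lerBrDr (le_trans (lerD (lexx _) Gx)) // -mulrDl ler_wpM2r //; lra.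
apply: le_trans (ler_norm _) _; apply: le_trans (meval_bound x hG bG) _.
rewrite ler_wpM2r // -/D mulrA ler_pdivrMr // -ler_pdivrMl // mulrC.
apply: le_trans (ltW (archi_boundP _)) _; last by rewrite ler_nat leqW.
by rewrite divr_ge0 ?(ltW e4) // !mulr_ge0.
Qed.

End UniformDenominators.

(** * Forms that vanish everywhere *)

Section VanishingForms.
Context {R : realType} {n : nat}.

Lemma sumsq_neq0 : sumsq != 0 :> {mpoly R[n.+1]}.
Proof.
apply/eqP => /(congr1 (meval (fun=> 1))); rewrite meval_sumsq meval0.
under eq_bigr do rewrite expr1n.
by rewrite sumr_const card_ord => /eqP; rewrite pnatr_eq0.
Qed.

(** If all values vanish, so do the weights in the polarized Hilbert identity. Cancelling [S ^ s]
    leaves [h = - S G_s], whose coefficients are of order [1/s] for every [s]. *)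
Lemma dhomog_eq0 d (h : {mpoly R[n.+1]}) :
  h \is d.-homog -> (forall x, h.@[x] = 0) -> h = 0.
Proof.
move=> hh h0; have [C C0 HC] := @polarized_hilbert R n.+1 d.
have [K K0 bh] := coef_bounded_ex h.
have small s : coef_bounded (n.+1%:R * (C * K / s.+1%:R)) h.
  have [G [_ bG] [u _]] := HC K h s hh bh.
  rewrite big1 => [|t _]; last by rewrite h0 mulr0 scale0r.
  rewrite exprS -mulrA mulrCA -mulrDr => /eqP.
  rewrite mulf_eq0 expf_eq0 (negPf sumsq_neq0) andbF /= addr_eq0 => /eqP-> m.
  rewrite mcoeffN normrN; apply: coef_bounded_sumsqM => //.
  by rewrite divr_ge0 // mulr_ge0.
apply/mpolyP => m; rewrite mcoeff0; apply/eqP; rewrite -normr_eq0 eq_le normr_ge0 andbT.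
apply/ler_addgt0Pl => e e0; rewrite addr0.
set B := n.+1%:R * (C * K); have B0 : 0 <= B by rewrite !mulr_ge0.
have Be0 : 0 <= B / e by rewrite divr_ge0 // ltW.
apply: le_trans (small (Num.bound (B / e)) m) _.
rewrite mulrA -/B ler_pdivrMr ?ltr0n // -ler_pdivrMl // mulrC.
by apply: le_trans (ltW (archi_boundP Be0)) _; rewrite ler_nat.
Qed.

End VanishingForms.

(** * Compactness and lower bounds for positive forms *)

Lemma meval_dhomog (R : comNzRingType) n d (p : {mpoly R[n]}) (c : R) (v : 'I_n -> R) :
  p \is d.-homog -> p.@[fun i => c * v i] = c ^+ d * p.@[v].
Proof.
move=> /dhomogP hp; rewrite !mevalE mulr_sumr big_seq [RHS]big_seq.
apply: eq_bigr => m /hp /= <-; rewrite mulrCA; congr (_ * _).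
rewrite mdegE expr_sum -big_split /=; apply: eq_bigr => i _.
by rewrite exprMn.
Qed.

Module PositiveForms.
From mathcomp Require Import boolp classical_sets functions topology normedtype derive realfun.
Import numFieldNormedType.Exports.
Local Open Scope classical_set_scope.

Lemma meval_continuous (R : realType) n (p : {mpoly R[n]}) :
  continuous (fun x : 'rV[R]_n => p.@[x 0]).
Proof.
have coordX (i : 'I_n) k : continuous (fun x : 'rV[R]_n => x 0 i ^+ k).
  move=> x; refine (@continuous_comp _ _ _ (fun x : 'rV[R]_n => x 0 i)
    (fun y : R => y ^+ k) x _ _).
    by move: x; refine (@coord_continuous R 1 n 0 i).
  by refine (@exprn_continuous R k _).
have prod_cont (m : 'X_{1..n}) (s : seq 'I_n) :
    continuous (fun x : 'rV[R]_n => \prod_(i <- s) x 0 i ^+ m i).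
  elim: s => [|i s IHs].
    under eq_fun do rewrite big_nil.
    by refine (@cst_continuous 'rV[R]_n R _).
  under eq_fun do rewrite big_cons.
  by move=> x; refine (continuousM (coordX i _ x) (IHs x)).
suff sum_cont (s : seq 'X_{1..n}) : continuous (fun x : 'rV[R]_n =>
    \sum_(m <- s) p@_m * \prod_i x 0 i ^+ m i).
  by under eq_fun do rewrite mevalE; exact: sum_cont.
elim: s => [|m s IHs].
  rewrite (_ : (fun x => _) = (fun=> 0)); last by apply: funext => x; rewrite big_nil.
  by refine (@cst_continuous 'rV[R]_n R _).
under eq_fun do rewrite big_cons.
move=> x; refine (continuousD (continuousM _ (prod_cont m _ x)) (IHs x)).
by refine (@cst_continuous 'rV[R]_n R _ x).
Qed.

(** [f] attains a positive minimum on the unit sphere of the maximum norm. Homogeneity and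
    [S(x) <= (n+1) |x| ^ 2] transfer it to all [x], which explains the divisor [(n+1) ^ d]. *)
Lemma form_lower_bound (R : realType) n d (f : {mpoly R[n.+1]}) :
  f \is d.*2.-homog -> (forall x : 'rV[R]_n.+1, x != 0 -> 0 < f.@[x 0]) ->
  exists2 e : R, 0 < e & forall x : 'I_n.+1 -> R, e * sumsq.@[x] ^+ d <= f.@[x].
Proof.
move=> hf fpos; pose A := [set x : 'rV[R]_n.+1 | `|x| = 1].
have AZ (x : 'rV[R]_n.+1) : x != 0 -> A (`|x|^-1 *: x).
  by move=> x0; rewrite /A /= normrZ normfV normr_id mulVf ?normr_eq0.
have A0 : A !=set0.
  exists (`|const_mx 1 : 'rV[R]_n.+1|^-1 *: const_mx 1); apply: AZ.
  by apply/eqP => /rowP /(_ 0); rewrite !mxE; apply/eqP/oner_neq0.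
have cA : compact A.
  apply: bounded_closed_compact.
    by exists 1; split=> // t t1 x /= ->; exact: ltW.
  rewrite (_ : A = (fun x : 'rV[R]_n.+1 => `|x|) @^-1` [set 1]) //.
  by apply: preimage_closed => [x _|]; [exact: norm_continuous|exact: closed_eq].
have [c + cmin] := EVT_min_rV A0 cA (continuous_subspaceT (@meval_continuous R n.+1 f)).
rewrite inE => c1.
have c0 : c != 0 by rewrite -normr_eq0 c1 oner_eq0.
have fc := fpos c c0.
have n0 : (0 : R) < n.+1%:R ^+ d by rewrite exprn_gt0.
exists (f.@[c 0] / n.+1%:R ^+ d); first exact: divr_gt0.
move=> x; pose X : 'rV[R]_n.+1 := \row_i x i.
have [y Ay XE] : exists2 y, A y & X = `|X| *: y.
  have [->|X0] := eqVneq X 0; first by exists c => //; rewrite normr0 scale0r.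
  exists (`|X|^-1 *: X); first exact: AZ.
  by rewrite scalerA divff ?normr_eq0 // scale1r.
have fx : f.@[x] = `|X| ^+ d.*2 * f.@[y 0].
  rewrite -(meval_dhomog _ _ hf); apply: meval_eq => i.
  by have /rowP/(_ i) := XE; rewrite !mxE.
have Sx : sumsq.@[x] <= n.+1%:R * `|X| ^+ 2.
  have -> : n.+1%:R * `|X| ^+ 2 = \sum_(i < n.+1) `|X| ^+ 2.
    by rewrite sumr_const card_ord mulr_natl.
  rewrite meval_sumsq; apply: ler_sum => i _; rewrite -real_normK ?num_real //.
  rewrite lerXn2r ?nnegrE // [leRHS]/Num.norm /= mx_normrE.
  by apply: (le_trans _ (le_bigmax _ _ (0, i))); rewrite mxE.
rewrite mulrAC ler_pdivrMr // fx.
have : sumsq.@[x] ^+ d <= n.+1%:R ^+ d * `|X| ^+ d.*2.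
  by rewrite -mul2n exprM -exprMn lerXn2r ?nnegrE ?meval_sumsq_ge0.
move=> /(ler_wpM2l (ltW fc)) /le_trans; apply.
have -> : `|X| ^+ d.*2 * f.@[y 0] * n.+1%:R ^+ d =
  f.@[y 0] * (n.+1%:R ^+ d * `|X| ^+ d.*2) by ring.
by rewrite ler_wpM2r ?cmin ?inE // mulr_ge0 ?exprn_ge0.
Qed.

End PositiveForms.

(** * Absorbing weights by roots, and convexity of even powers *)

Lemma nonneg_root (R : rcfType) (k : nat) (c : R) :
  (0 < k)%N -> 0 <= c -> exists r : R, r ^+ k = c.
Proof.
move=> k0 c0; have [||x _] := @poly_ivt _ ('X^k - c%:P) 0 (1 + c); first by rewrite addr_ge0.
  rewrite !hornerE expr0n gtn_eqF //= sub0r oppr_le0 c0 subr_ge0 /=.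
  apply: (@le_trans _ _ (1 + c)); first by rewrite lerDr.
  by rewrite ler_eXnr // lerDl.
by rewrite rootE !hornerE subr_eq0 => /eqP; exists x.
Qed.

Section Convexity.
Context {R : realType} {n : nat}.
Implicit Types (p f : {mpoly R[n]}) (x y : 'rV[R]_n).

Lemma power_cone_even k p : (0 < k)%N -> power_cone k.*2 p ->
  sum_of_even_powers_of_linear p.
Proof.
move=> k0 [s /allP hs ->].
pose t0 : R * {mpoly R[n]} := (0, 0).
have ts (i : 'I_(size s)) : 0 <= (nth t0 s i).1 /\ (nth t0 s i).2 \is 1.-homog.
  by apply/andP/hs/mem_nth.
have k20 : (0 < k.*2)%N by rewrite double_gt0.
have /fin_all_exists[c hc] (i : 'I_(size s)) : exists r, r ^+ k.*2 = (nth t0 s i).1.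
  by apply: nonneg_root => //; case: (ts i).
exists (size s), (fun i => c i *: (nth t0 s i).2), (fun=> k); split=> // [i|].
  by apply: dhomogZ; case: (ts i).
rewrite (big_nth t0) big_mkord; apply: eq_bigr => i _.
by rewrite exprZn mul2n hc.
Qed.

Lemma convex_functionP (F : 'rV[R]_n -> R) :
  convex_function setT F <->
  forall t x y, 0 <= t -> t <= 1 -> F (t *: x + (1 - t) *: y) <= t * F x + (1 - t) * F y.
Proof.
split=> [cF t x y t0 t1|cF t x y _ _].
  have := cF (Itv01 t0 t1) x y; rewrite !in_setT; exact.
by apply: cF.
Qed.

(** The induction step is Chebyshev's inequality: the defect is [t (1 - t) (a - b) (a ^ k - b ^ k)],
    whose last two factors have the same sign. *)
Lemma convex_pow (a b t : R) k : 0 <= a -> 0 <= b -> 0 <= t -> t <= 1 ->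
  (t * a + (1 - t) * b) ^+ k <= t * a ^+ k + (1 - t) * b ^+ k.
Proof.
move=> a0 b0 t0 t1; have t1' : 0 <= 1 - t by rewrite subr_ge0.
elim: k => [|k IHk]; first by rewrite !expr0; lra.
rewrite exprS; apply: le_trans (ler_wpM2l _ IHk) _.
  by rewrite addr_ge0 // mulr_ge0.
rewrite -subr_ge0 !exprS.
have -> : t * (a * a ^+ k) + (1 - t) * (b * b ^+ k) -
    (t * a + (1 - t) * b) * (t * a ^+ k + (1 - t) * b ^+ k) =
  t * (1 - t) * ((a - b) * (a ^+ k - b ^+ k)) by ring.
apply: mulr_ge0; first exact: mulr_ge0.
case: (leP a b) => [ab|/ltW ab].
  by rewrite mulr_le0 // subr_le0 // lerXn2r.
by rewrite mulr_ge0 // subr_ge0 // lerXn2r.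
Qed.

(** The square is convex, and the [k]-th power is increasing and convex on nonnegative numbers. *)
Lemma convex_even_pow (a b t : R) k : 0 <= t -> t <= 1 ->
  (t * a + (1 - t) * b) ^+ (2 * k) <= t * a ^+ (2 * k) + (1 - t) * b ^+ (2 * k).
Proof.
move=> t0 t1; have t1' : 0 <= 1 - t by rewrite subr_ge0.
have sq : (t * a + (1 - t) * b) ^+ 2 <= t * a ^+ 2 + (1 - t) * b ^+ 2.
  rewrite -subr_ge0.
  have -> : t * a ^+ 2 + (1 - t) * b ^+ 2 - (t * a + (1 - t) * b) ^+ 2 =
    t * (1 - t) * (a - b) ^+ 2 by ring.
  by apply: mulr_ge0; [exact: mulr_ge0|exact: sqr_ge0].
rewrite !exprM; apply: le_trans (convex_pow _ _ _ t0 t1); rewrite ?sqr_ge0 //.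
by rewrite lerXn2r // nnegrE ?sqr_ge0 // addr_ge0 // mulr_ge0 // sqr_ge0.
Qed.

Lemma polyfun_linear p t x y : p \is 1.-homog ->
  polyfun p (t *: x + (1 - t) *: y) = t * polyfun p x + (1 - t) * polyfun p y.
Proof.
move=> hp; rewrite /polyfun !mevalE !mulr_sumr -big_split big_seq [RHS]big_seq /=.
apply: eq_bigr => m /(dhomog_mf hp) /= /eqP/mdeg1P[i /eqP->].
rewrite -!mevalX !mevalXU !mxE; ring.
Qed.

Lemma even_powers_convex p :
  sum_of_even_powers_of_linear p -> convex_function setT (polyfun p).
Proof.
move=> [m [l [k [hl _ ->]]]]; apply/convex_functionP => t x y t0 t1.
rewrite /polyfun !raddf_sum /= !mulr_sumr -big_split /=; apply: ler_sum => i _.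
rewrite !rmorphXn /= -!/(polyfun _ _) polyfun_linear //.
exact: convex_even_pow.
Qed.

End Convexity.

(** * Positivity against convexity for forms in at least one variable *)

Section FormsOfPositiveDimension.
Context {R : realType} {n d : nat} {f : {mpoly R[n.+1]}}.
Hypotheses (f_neq0 : f != 0) (f_homog : f \is d.-homog).
Implicit Types (x y : 'rV[R]_n.+1).

Lemma psi_homog N : psi f N \is (2 * N + d).-homog.
Proof. by rewrite dhomogM // dhomogMn // sumsq_homog. Qed.

Lemma polyfunZ p e c x : p \is e.-homog -> polyfun p (c *: x) = c ^+ e * polyfun p x.
Proof.
move=> hp; rewrite /polyfun -(meval_dhomog _ _ hp).
by apply: meval_eq => i; rewrite mxE.
Qed.

Definition sqn x := \sum_(i < n.+1) x 0 i ^+ 2.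

Lemma polyfun_psi N x : polyfun (psi f N) x = sqn x ^+ N * polyfun f x.
Proof. by rewrite /polyfun /psi mevalM rmorphXn /= meval_sumsq. Qed.

Lemma sqn_gt0 x : x != 0 -> 0 < sqn x.
Proof.
move=> x0; rewrite lt_neqAle sumr_ge0 ?andbT => [|i _]; last exact: sqr_ge0.
apply: contra x0; rewrite eq_sym psumr_eq0 => [/allP h|i _]; last exact: sqr_ge0.
apply/eqP/rowP => i; rewrite mxE; apply/eqP.
by have := h i (mem_index_enum _); rewrite /= sqrf_eq0.
Qed.

Lemma positive_even_powers : (forall x, x != 0 -> 0 < polyfun f x) ->
  exists N1 : nat, (0 < N1)%N /\ forall N : nat, (N1 <= N)%N ->
    sum_of_even_powers_of_linear (psi f N).
Proof.
move=> fpos.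
have d_even : ~~ odd d.
  apply/negP => od; pose e : 'rV[R]_n.+1 := const_mx 1.
  have e0 : e != 0 by apply/eqP => /rowP /(_ 0); rewrite !mxE; apply/eqP/oner_neq0.
  have := fpos (-1 *: e); rewrite scaler_eq0 oppr_eq0 oner_eq0 => /(_ e0).
  by rewrite (polyfunZ _ _ f_homog) -signr_odd od mulN1r oppr_gt0 lt_gtF // fpos.
have dE : d = d./2.*2 by rewrite -[LHS]odd_double_half (negPf d_even).
have hf : f \is d./2.*2.-homog by rewrite -dE.
have [e e0 he] := PositiveForms.form_lower_bound hf fpos.
have [K _ bf] := coef_bounded_ex f.
have [N0 HN] := @uniform_denominators R n.+1 d./2 e K e0.
(* The successor makes [N] positive, so that the exponent [2 (N + d/2)] is not 0. *)
exists N0.+1; split=> // N ltN; apply: (@power_cone_even _ _ (N + d./2)).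
  by rewrite addn_gt0 (leq_trans _ ltN).
exact: HN (ltnW ltN) f hf bf he.
Qed.

Lemma psi_nonzero_point N : exists x, polyfun (psi f N) x != 0.
Proof.
apply: boolp.contrapT => h.
have /eqP : psi f N = 0.
  apply: (dhomog_eq0 (psi_homog N)) => z; apply/eqP/negPn/negP => nz.
  apply: h; exists (\row_i z i); rewrite /polyfun.
  by rewrite (meval_eq (v2 := z)) // => i; rewrite mxE.
by rewrite mulf_eq0 expf_eq0 (negPf f_neq0) (negPf sumsq_neq0) andbF.
Qed.

Lemma convex_midpoint N : convex_function setT (polyfun (psi f N)) ->
  forall x y z, x + y = 2 *: z ->
  2 * polyfun (psi f N) z <= polyfun (psi f N) x + polyfun (psi f N) y.
Proof.
move=> /convex_functionP cv x y z xyz.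
have := cv (1 / 2) x y; rewrite (_ : _ *: x + _ *: y = z).
  have h0 : (0 : R) <= 1 / 2 by lra.
  have h1 : (1 / 2 : R) <= 1 by lra.
  by move=> /(_ h0 h1); lra.
have -> : (1 - 1 / 2 : R) = 1 / 2 by field.
by rewrite -scalerDr xyz scalerA mul1r mulVf ?scale1r // pnatr_eq0.
Qed.

(** For odd degree [k], the midpoint [w] of [3 w] and [- w] gives [(3 ^ k - 3) g(w) >= 0]. Taking
    [w = z] and [w = - z] forces [g(z) = 0], because [N > 0] gives [k > 1]. *)
Lemma convex_even N : (0 < N)%N -> convex_function setT (polyfun (psi f N)) -> ~~ odd d.
Proof.
move=> N0 cv; apply/negP => od.
have [z] := psi_nonzero_point N; set k := (2 * N + d)%N.
have ok : odd k by rewrite oddD oddM od.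
have hZ c x : polyfun (psi f N) (c *: x) = c ^+ k * polyfun (psi f N) x.
  exact/polyfunZ/psi_homog.
have m1k : (-1 : R) ^+ k = -1 by rewrite -signr_odd ok.
have H w : 2 * polyfun (psi f N) w <= (3 ^+ k - 1) * polyfun (psi f N) w.
  have := convex_midpoint cv (x := 3 *: w) (y := -1 *: w) (z := w).
  rewrite !hZ m1k mulrBl mul1r mulN1r; apply.
  by rewrite -scalerDl; congr (_ *: _); ring.
have k3 : (3 : R) < 3 ^+ k.
  rewrite -[X in X < _]expr1 ltr_eXn2l ?ltr1n // (@leq_trans (2 * N)) ?leq_addr //.
  by case: (N) N0 => // j _; rewrite mulnS.
have := H z; have := H (-1 *: z); rewrite hZ m1k.
set g := polyfun _ z => H1 H2; move/negP; apply.
have : (3 ^+ k - 3) * g = 0 by lra.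
by move/eqP; rewrite mulf_eq0 subr_eq0 gt_eqF.
Qed.

(** The degree is even and positive, so the midpoint 0 of [x] and [- x] gives [0 <= 2 g(x)]. *)
Lemma convex_nonneg N : (0 < N)%N -> convex_function setT (polyfun (psi f N)) ->
  forall x, 0 <= polyfun (psi f N) x.
Proof.
move=> N0 cv x; have ed := convex_even N0 cv; have hN := psi_homog N.
have := convex_midpoint cv (x := x) (y := -1 *: x) (z := 0 *: x).
rewrite !(polyfunZ _ _ hN) expr0n -signr_odd oddD oddM (negPf ed) /=.
rewrite gtn_eqF ?addn_gt0 ?muln_gt0 ?N0 //= mul0r mulr0 mul1r.
move=> h; suff : 0 <= polyfun (psi f N) x + polyfun (psi f N) x by lra.
by apply: h; rewrite scaleN1r subrr scale0r scaler0.
Qed.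

Lemma sqn_parallelogram x y : sqn (x + y) + sqn (x - y) = 2 * sqn x + 2 * sqn y.
Proof.
rewrite /sqn !mulr_sumr -!big_split /=; apply: eq_bigr => i _.
by rewrite !mxE; ring.
Qed.

Lemma sqnZ c x : sqn (c *: x) = c ^+ 2 * sqn x.
Proof. by rewrite /sqn mulr_sumr; apply: eq_bigr => i _; rewrite mxE exprMn. Qed.

Lemma sqn_ge0 x : 0 <= sqn x.
Proof. by apply: sumr_ge0 => i _; exact: sqr_ge0. Qed.

(* If [f] vanished at [x != 0], the convex forms [psi f N] and [psi f N.+1] would both be
   bounded above and below along the line [z + R x], and so would be their ratio [sqn]. *)
Lemma convex_positive N0 : (0 < N0)%N ->
  (forall N, (N0 <= N)%N -> convex_function setT (polyfun (psi f N))) ->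
  forall x, x != 0 -> 0 < polyfun f x.
Proof.
move=> N0_gt0 cv x x0; have sx := sqn_gt0 x0.
have cv0 := cv N0 (leqnn _); have cv1 := cv N0.+1 (leqnSn _).
rewrite lt_neqAle; apply/andP; split; last first.
  have := convex_nonneg N0_gt0 cv0 x.
  by rewrite polyfun_psi pmulr_rge0 // exprn_gt0.
rewrite eq_sym; apply/negP => /eqP fx.
have vanish N c : polyfun (psi f N) (c *: x) = 0.
  by rewrite (polyfunZ _ _ (psi_homog N)) polyfun_psi fx !mulr0.
have [z gz0] := psi_nonzero_point N0.
have gz : 0 < polyfun (psi f N0) z by rewrite lt_neqAle eq_sym gz0 convex_nonneg.
pose k := (2 * N0 + d)%N; pose M := 4 ^+ k * sqn z.
have bound t : sqn (z + t *: x) <= M.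
  (* [z] is the midpoint of [2 (z + t x)] and [- 2 t x], while [z + t x] is that of [2 z] and
     [2 t x]. The forms vanish on multiples of [x], so each inequality keeps one term; dividing them
     gives the constant [4 ^ k]. *)
  have H2 : 2 * polyfun (psi f N0) z <= 2 ^+ k * polyfun (psi f N0) (z + t *: x).
    have := convex_midpoint cv0 (x := 2 *: (z + t *: x)) (y := (- (2 * t)) *: x) (z := z).
    rewrite vanish addr0 (polyfunZ _ _ (psi_homog _)); apply.
    by rewrite scalerDr scalerA scaleNr addrK.
  have H1 : 2 * polyfun (psi f N0.+1) (z + t *: x) <=
      2 ^+ (2 * N0.+1 + d) * polyfun (psi f N0.+1) z.
    have := convex_midpoint cv1 (x := 2 *: z) (y := (2 * t) *: x) (z := z + t *: x).
    rewrite vanish addr0 (polyfunZ _ _ (psi_homog _)); apply.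
    by rewrite scalerDr scalerA.
  have psiS w : polyfun (psi f N0.+1) w = sqn w * polyfun (psi f N0) w.
    by rewrite !polyfun_psi exprS mulrA.
  have kS : (2 * N0.+1 + d = k + 2)%N by rewrite mulnS [(2 + _)%N]addnC addnAC.
  move: H1 H2; rewrite kS !psiS exprD; set a := sqn (z + _); set g := polyfun _ _; set g' := polyfun _ z.
  set P := 2 ^+ k => H1 H2.
  have P0 : 0 < P by rewrite exprn_gt0.
  have a0 : 0 <= a by exact: sqn_ge0.
  have := ler_wpM2l a0 H2; have := ler_wpM2l (ltW P0) H1 => H1' H2'.
  rewrite -(ler_pM2r gz) -/g' /M (_ : 4 ^+ k = P * P); last first.
    by rewrite /P -exprMn; congr (_ ^+ _); ring.
  suff : 2 * (a * g') <= 2 * (P * P * sqn z * g') by lra.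
  nra.
(* With this [t >= 1], [t ^ 2 sqn x >= sqn x + M > M], against the bounds at [z + t x] and [z - t x]
   added by the parallelogram law. *)
pose t := 1 + M / sqn x.
have M0 : 0 <= M by rewrite mulr_ge0 ?exprn_ge0 ?sqn_ge0.
have t1 : 1 <= t by rewrite lerDl divr_ge0 // ltW.
have tx : t * sqn x = sqn x + M by rewrite mulrDl mul1r divfK ?gt_eqF.
have := sqn_parallelogram z (t *: x); have := bound t; have := bound (- t).
rewrite scaleNr sqnZ => b1 b2 eq.
have tt : t * sqn x <= t ^+ 2 * sqn x by rewrite ler_wpM2r ?(ltW sx) // expr2 ler_peMr // (le_trans _ t1).
by have := sqn_ge0 z; lra.
Qed.

End FormsOfPositiveDimension.

(** * Restriction to lines and strict convexity *)

Lemma poly_eq0_on_itv (R : realFieldType) (p : {poly R}) (a b : R) :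
  a < b -> (forall u, a <= u -> u <= b -> p.[u] = 0) -> p = 0.
Proof.
move=> ab p0; pose pt (i : nat) := a + (b - a) / i.+1%:R.
have ba : 0 < b - a by rewrite subr_gt0.
have pt_inj : injective pt.
  move=> i j /addrI /(mulfI (lt0r_neq0 ba)) /invr_inj /eqP.
  by rewrite eqr_nat eqSS => /eqP.
apply: (@roots_geq_poly_eq0 _ p [seq pt i | i <- iota 0 (size p)]).
- apply/allP => _ /mapP[i _ ->]; apply/rootP/p0; rewrite /pt.
    by rewrite lerDl divr_ge0 // ltW.
  by rewrite -lerBrDl ler_pdivrMr // ler_peMr ?ler1n // ltW.
- by rewrite map_inj_uniq // iota_uniq.
- by rewrite size_map size_iota.
Qed.

Lemma polyfun_line (R : realType) n (p : {mpoly R[n]}) (v y : 'rV[R]_n) :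
  exists q : {poly R}, forall u, q.[u] = polyfun p (v + u *: y).
Proof.
exists (\sum_(m <- msupp p) (p@_m)%:P *
  \prod_i ((v 0 i)%:P + (y 0 i) *: 'X) ^+ m i) => u.
rewrite /polyfun mevalE horner_sum; apply: eq_bigr => m _.
rewrite hornerCM horner_prod; congr (_ * _); apply: eq_bigr => i _.
by rewrite horner_exp !hornerE !mxE mulrC.
Qed.

(* Equality in the convexity inequality makes [g = psi f N] affine on a segment [y + s v];
   in the variable [u = 1 / s], homogeneity then forces the polynomial [g (v + u y)] to be
   [A u ^ (k - 1) + B u ^ k], so [g v = 0]. *)
Lemma convex_strictly (R : realType) n d (f : {mpoly R[n.+1]}) N :
  f \is d.-homog -> (0 < N)%N -> (forall x : 'rV[R]_n.+1, x != 0 -> 0 < polyfun f x) ->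
  convex_function setT (polyfun (psi f N)) ->
  strictly_convex_function setT (polyfun (psi f N)).
Proof.
move=> hf N0 fpos /convex_functionP cv t t0 t1 x y _ _ xy.
have hg := psi_homog hf N; set g := polyfun (psi f N) in cv *.
change (g (t%:num *: x + (1 - t%:num) *: y) < t%:num * g x + (1 - t%:num) * g y).
move: (t%:num) t0 t1 => {}t t0 t1; rewrite ltNge; apply/negP => eq_t.
pose k := (2 * N + d)%N.
have gZ c z : g (c *: z) = c ^+ k * g z by apply: polyfunZ.
(* The point of weight [t] is the combination, with weight [t / s], of the point of weight [s] and
   [y]. A strict inequality at [s] would give one at [t]. *)
have affine s : t <= s -> s <= 1 -> g (s *: x + (1 - s) *: y) = s * g x + (1 - s) * g y.
  move=> ts s1; have s0 : 0 < s by apply: lt_le_trans ts.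
  apply/eqP; rewrite eq_le cv ?(ltW s0) //=.
  have r0 : 0 <= t / s by rewrite divr_ge0 ?ltW.
  have r1 : t / s <= 1 by rewrite ler_pdivrMr // mul1r.
  have := cv (t / s) (s *: x + (1 - s) *: y) y r0 r1.
  have -> : (t / s) *: (s *: x + (1 - s) *: y) + (1 - t / s) *: y =
      t *: x + (1 - t) *: y.
    rewrite scalerDr !scalerA -addrA -scalerDl divfK ?gt_eqF //; congr (_ + _ *: _).
    by field; rewrite gt_eqF.
  move=> /(le_trans eq_t) h; rewrite -(ler_pM2l (divr_gt0 t0 s0)).
  rewrite mulrDr !mulrA divfK ?gt_eqF //.
  have -> : t / s * (1 - s) = t / s - t by field; rewrite gt_eqF.
  by move: h; rewrite !mulrBl !mul1r; lra.
have v0 : x - y != 0 by rewrite subr_eq0.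
have [q qE] := polyfun_line (psi f N) (x - y) y; rewrite -/g in qE.
have k2 : (2 <= k)%N by rewrite (@leq_trans (2 * N)) ?leq_addr // leq_pmulr.
have kE : k = k.-2.+2 by case: (k) k2 => [|[]].
(* For [s = 1 / u] the point on the segment is [(v + u y) / u] with [v = x - y]; multiplying the
   affine formula by [u ^ k] yields these two monomials for [u] in [[1, 1 / t]]. *)
pose w : {poly R} := q - (g x - g y) *: 'X^(k.-1) - g y *: 'X^k.
have w0 : w = 0.
  apply: (@poly_eq0_on_itv _ w 1 t^-1) => [|u u1 ut]; first by rewrite invf_gt1.
  have u0 : 0 < u by apply: lt_le_trans u1.
  have s1 : u^-1 <= 1 by rewrite invf_le1.
  have s2 : t <= u^-1 by rewrite -(invrK t) lef_pV2 // posrE ?invr_gt0.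
  have := affine _ s2 s1.
  have -> : u^-1 *: x + (1 - u^-1) *: y = u^-1 *: (x - y + u *: y).
    rewrite scalerDr scalerBr scalerBl scale1r scalerA mulVf ?gt_eqF // scale1r.
    by rewrite addrA addrAC.
  rewrite gZ -qE => /(congr1 ( *%R (u ^+ k))).
  rewrite mulrA -exprMn divff ?gt_eqF // expr1n mul1r !hornerE => ->.
  rewrite kE /= !exprS; field; rewrite gt_eqF //.
(* The polynomial identity extends to [u = 0], where both monomials vanish because [k >= 2]; hence
   [g (x - y) = 0], against positivity. *)
have := congr1 (horner^~ 0) w0; rewrite !hornerE qE scale0r addr0 kE /=.
rewrite !expr0n /= !mulr0 !subr0 => /eqP; rewrite gt_eqF //.
by rewrite /g polyfun_psi mulr_gt0 ?exprn_gt0 ?sqn_gt0 // fpos.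
Qed.

Lemma strictly_convex_convex (R : numFieldType) (E : lmodType R)
    (F : convex_lmodType E -> R^o) :
  strictly_convex_function setT F -> convex_function setT F.
Proof.
move=> sF t x y _ _; have [->|xy] := eqVneq x y; first by rewrite !convmm.
have [->|t0] := eqVneq t 0%:i01; first by rewrite !conv0.
have [->|t1] := eqVneq t 1%:i01; first by rewrite !conv1.
apply/ltW/sF; rewrite ?in_setT //.
  by rewrite lt_neqAle eq_sym ge0 andbT.
by rewrite lt_neqAle le1 andbT.
Qed.

(** * The cycle of implications *)

Theorem corollary5p8 (R : realType) (n d : nat) (f : {mpoly R[n]})
    (f_neq0 : f != 0) (f_homog : f \is d.-homog) :
  [<->
    (* a *)
    forall x : 'rV[R]_n, x != 0 -> 0 < polyfun f x;
    (* b *)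
    exists N1 : nat, (0 < N1)%N /\ forall N : nat, (N1 <= N)%N ->
      sum_of_even_powers_of_linear (psi f N);
    (* c *)
    exists N2 : nat, (0 < N2)%N /\ forall N : nat, (N2 <= N)%N ->
      convex_function setT (polyfun (psi f N));
    (* d *)
    exists N3 : nat, (0 < N3)%N /\ forall N : nat, (N3 <= N)%N ->
      strictly_convex_function setT (polyfun (psi f N))].
Proof.
have b_to_c : (exists N1 : nat, (0 < N1)%N /\ forall N : nat, (N1 <= N)%N ->
      sum_of_even_powers_of_linear (psi f N)) ->
    exists N2 : nat, (0 < N2)%N /\ forall N : nat, (N2 <= N)%N ->
      convex_function setT (polyfun (psi f N)).
  by move=> [N1 [N1_gt0 HN]]; exists N1; split=> // N /HN; apply: even_powers_convex.
have d_to_c : (exists N3 : nat, (0 < N3)%N /\ forall N : nat, (N3 <= N)%N ->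
      strictly_convex_function setT (polyfun (psi f N))) ->
    exists N2 : nat, (0 < N2)%N /\ forall N : nat, (N2 <= N)%N ->
      convex_function setT (polyfun (psi f N)).
  move=> [N3 [N3_gt0 HN]]; exists N3; split=> // N /HN; exact: strictly_convex_convex.
(* In dimension 0 the space is one point and [S = 0], so all four conditions hold: for [N > 0] the
   polynomial [psi f N] is 0, the empty sum of even powers. *)
case: n f f_neq0 f_homog b_to_c d_to_c => [|n] f f_neq0 f_homog b_to_c d_to_c; tfae.
- move=> _; exists 1%N; split=> // N N_gt0.
  exists 0%N, (fun=> 0), (fun=> 1%N); split=> // [i|]; first exact: dhomog0.
  by rewrite /psi !big_ord0 expr0n gtn_eqF ?mul0r.
- exact: b_to_c.
- move=> _; exists 1%N; split=> // N _ t _ _ x y _ _.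
  by rewrite [x]thinmx0 [y]thinmx0 eqxx.
- by move=> _ x; rewrite [x]thinmx0 eqxx.
- exact: positive_even_powers f_homog.
- exact: b_to_c.
- move=> [N0 [N0_gt0 HN]]; exists N0; split=> // N leN.
  apply: (convex_strictly f_homog); first exact: leq_trans leN.
    exact: (convex_positive f_neq0 f_homog N0_gt0 HN).
  exact: HN.
- move=> /d_to_c[N0 [N0_gt0 HN]].
  exact: (convex_positive f_neq0 f_homog N0_gt0 HN).
Qed.
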